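(* For every integer $n\ge 1$, $\max_{\mu}(n) \ge 2^{\lfloor n/4\rfloor - 1}$, where $\max_{\mu}(n)=\max\{\,|\mu[1,\pi]| : \pi \text{ a permutation with } |\pi|=n\,\}$.
   Context: Permutations are written in one-line notation, and $|\pi|$ denotes the length of a permutation $\pi$ (while $|\mu[1,\pi]|$ is an absolute value). A permutation $\sigma=\sigma_1\cdots\sigma_m$ is contained in $\pi=\pi_1\cdots\pi_n$, written $\sigma\le\pi$, if there are indices $1\le i_1<\dots<i_m\le n$ such that for all $r,s\in\{1,\dots,m\}$, $\pi_{i_r}<\pi_{i_s}$ if and only if $\sigma_r<\sigma_s$. The set of all (non-empty) permutations of all lengths is a poset under $\le$. The Möbius function on this poset is defined by: $\mu[\sigma,\pi]=0$ if $\sigma\nleq\pi$; $\mu[\pi,\pi]=1$; and for $\sigma<\pi$, $\mu[\sigma,\pi]=-\sum_{\sigma\le\lambda<\pi}\mu[\sigma,\lambda]$. In $\mu[1,\pi]$, the symbol $1$ is the permutation of length 1. *)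

(* Defs.v *)
From HB Require Import structures.
From mathcomp Require Import all_boot all_order all_algebra all_fingroup.
Set Implicit Arguments. Unset Strict Implicit. Unset Printing Implicit Defensive.
Import Order.TTheory GRing.Theory Num.Theory.

(* A non-empty permutation of any length: [existT _ n p] has length n.+1, and
   its one-line notation is p 0, ..., p n, with values counted from 0. *)
Definition permutation : Type := {n : nat & 'S_n.+1}.

HB.instance Definition _ := Countable.on permutation.

Definition perm_of n (p : 'S_n.+1) : permutation := Tagged (fun n => 'S_n.+1) p.

Definition length (p : permutation) : nat := (tag p).+1.

Definition contained (s p : permutation) : bool :=
  [exists i : {ffun 'I_(length s) -> 'I_(length p)},
    [forall r : 'I_(length s), forall t : 'I_(length s),
      ((r < t) ==> (i r < i t)) &&
      ((tagged p (i r) < tagged p (i t)) == (tagged s r < tagged s t))]].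

Lemma containedP (s p : permutation) :
  reflect (exists i : 'I_(length s) -> 'I_(length p),
             {homo i : r t / (r < t)%N} /\
             forall r t, (tagged p (i r) < tagged p (i t))
                           = (tagged s r < tagged s t))
          (contained s p).
Proof.
apply: (iffP existsP) => [[i /forallP h]|[i [h1 h2]]].
  exists i; split=> r t; have /forallP/(_ t)/andP[/implyP h1 /eqP h2] := h r.
    exact: h1.
  exact: h2.
exists (finfun i); apply/forallP=> r; apply/forallP=> t.
rewrite !ffunE h2 eqxx andbT; apply/implyP; exact: h1.
Qed.

Lemma contained_refl : reflexive contained.
Proof. by move=> p; apply/containedP; exists id; split. Qed.

Lemma contained_trans : transitive contained.
Proof.
move=> q s p /containedP[i [i1 i2]] /containedP[j [j1 j2]].
apply/containedP; exists (j \o i); split=> [r t rt|r t] /=.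
  by apply: j1; apply: i1.
by rewrite j2 i2.
Qed.

Lemma homo_ltn_inj m n (i : 'I_m -> 'I_n) :
  {homo i : r t / (r < t)%N} -> injective i.
Proof.
move=> h r t e; apply/val_inj; case: (ltngtP r t) => // /h; by rewrite e ltnn.
Qed.

Lemma contained_length s p : contained s p -> length s <= length p.
Proof.
case/containedP=> i [/homo_ltn_inj/leq_card h _].
by move: h; rewrite !card_ord.
Qed.

Lemma contained_perm n (s p : 'S_n.+1) :
  contained (perm_of s) (perm_of p) -> s = p.
Proof.
case/containedP=> /= i [i1 i2].
have iid r : i r = r.
  have lo (k : nat) (hk : k < n.+1) : k <= i (Ordinal hk).
    elim: k hk => // k IH hk; apply: leq_ltn_trans (IH (ltnW hk)) _.
    exact: i1.
  have hi (k : nat) (r' : 'I_n.+1) : r' + k = n -> i r' + k <= n.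
    elim: k r' => [|k IH] r' e; first by rewrite addn0 -ltnS.
    have h : r'.+1 < n.+1.
      by move: e; rewrite addnS ltnS => e'; rewrite -[leqRHS]e' ltnS leq_addr.
    have := IH (Ordinal h); rewrite /= addSnnS => /(_ e); apply: leq_trans.
    by rewrite addnS -addSn leq_add2r; apply: i1.
  apply/val_inj/eqP; rewrite eqn_leq; case: r => r hr; rewrite lo andbT.
  have := hi (n - r) (Ordinal hr); rewrite /= subnKC // => /(_ erefl) h.
  by rewrite -(leq_add2r (n - r)) subnKC.
have st r t : (s r < s t) = (p r < p t) by rewrite -i2 !iid.
have rank (q : 'S_n.+1) r : val (q r) = #|[set t | q t < q r]|.
  rewrite -(card_imset _ (@perm_inj _ q)).
  have -> : q @: [set t | q t < q r] = [set x : 'I_n.+1 | x < q r].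
    apply/setP=> x; rewrite inE; apply/imsetP/idP => [[t]|xr].
      by rewrite inE => h ->.
    by exists ((q^-1)%g x); rewrite ?inE permKV.
  rewrite -sum1_card (eq_bigl (fun x : 'I_n.+1 => x < q r)); last first.
    by move=> x; rewrite inE.
  by rewrite (big_ord_narrow (ltnW (ltn_ord (q r)))) sum1_card card_ord.
apply/permP=> r; apply/val_inj; rewrite [LHS]rank [RHS]rank.
by apply: eq_card => t; rewrite !inE st.
Qed.

Lemma contained_anti : antisymmetric contained.
Proof.
move=> s p /andP[sp ps].
have : tag s = tag p.
  by apply/eqP; rewrite -eqSS eqn_leq !(contained_length sp, contained_length ps).
case: s p sp ps => m s [n p] /= sp _ e; case: _ / e p sp => p sp.
by rewrite (contained_perm sp).
Qed.

Fact perm_display : Order.disp_t. Proof. exact: Order.Disp tt tt. Qed.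

HB.instance Definition _ := Order.Le_isPOrder.Build perm_display permutation
  contained_refl contained_anti contained_trans.

Lemma leEcontained (s p : permutation) : (s <= p)%O = contained s p.
Proof. by []. Qed.

Lemma perm_lt_length (s p : permutation) : (s < p)%O -> length s < length p.
Proof.
rewrite lt_neqAle leEcontained => /andP[ne sp].
rewrite ltn_neqAle contained_length // andbT; apply: contra ne.
rewrite eqSS => /eqP.
case: s p sp => m s [n p] /= sp e; case: _ / e p sp => p sp.
by rewrite (contained_perm sp).
Qed.

(* The first argument bounds the recursion depth; the value is the intended one
   as soon as it is at least [length p]. *)
Fixpoint mobius_rec (d : nat) (s p : permutation) : int :=
  if d is d'.+1 then
    if ~~ (s <= p)%O then 0%R
    else if s == p then 1%R
    else (- \sum_(k < length p) \sum_(l : 'S_k.+1 | (s <= perm_of l < p)%O)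
              mobius_rec d' s (perm_of l))%R
  else 0%R.

Definition mobius (s p : permutation) : int := mobius_rec (length p) s p.

Lemma mobius_rec_enough d s p : length p <= d -> mobius_rec d s p = mobius s p.
Proof.
rewrite /mobius; have [b] := ubnP d; elim: b d p => // b IH [|d] p //= db pd.
case: ifP => // _; case: ifP => // _; congr (- _)%R.
apply: eq_bigr => k _; apply: eq_bigr => l /andP[_ /perm_lt_length lp].
have le_l : length (perm_of l) <= tag p by rewrite -ltnS.
have le_pd : tag p <= d by rewrite -ltnS.
rewrite (IH d) ?(leq_trans le_l) // [RHS]IH //.
exact: leq_ltn_trans le_pd db.
Qed.

(* The defining equations of the Moebius function; by [perm_lt_length] the last
   sum runs over every l with s <= l < p. *)
Lemma mobius_nle (s p : permutation) : ~~ (s <= p)%O -> mobius s p = 0%R.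
Proof. by rewrite /mobius /= => ->. Qed.

Lemma mobius_refl (p : permutation) : mobius p p = 1%R.
Proof. by rewrite /mobius /= lexx eqxx. Qed.

Lemma mobius_lt (s p : permutation) : (s < p)%O ->
  mobius s p =
  (- \sum_(k < length p) \sum_(l : 'S_k.+1 | (s <= perm_of l < p)%O)
       mobius s (perm_of l))%R.
Proof.
move=> sp; rewrite {1}/mobius /= (ltW sp) (lt_eqF sp) /=; congr (- _)%R.
apply: eq_bigr => k _; apply: eq_bigr => l /andP[_ /perm_lt_length lp].
by rewrite mobius_rec_enough.
Qed.

Definition one : permutation := perm_of (1%g : 'S_1).

(* For n >= 1, the permutations of length n are the elements of 'S_n.-1.+1. *)
Definition max_mu (n : nat) : nat :=
  \max_(p : 'S_n.-1.+1) `|mobius one (perm_of p)|%N.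

(* Main.v *)
Require Import Defs.
From mathcomp Require Import all_boot all_order all_algebra all_fingroup.
Import GRing.Theory Num.Theory.
From mathcomp Require Import zify ring.
Import Defs Order.POrderTheory.
Set Implicit Arguments.
Unset Strict Implicit.
Unset Printing Implicit Defensive.

(** Write mu l for the Moebius value of the interval from 1 to l.  The balloon
    of b is 25314[1,1,b,1,1]: four points in the pattern 2413 placed around b,
    so that 2413 is the balloon of the empty permutation.  The theorem follows
    from [mu_balloon]: for b other than 1, the balloon of b has the same mu as
    b, and twice that mu when b is itself a balloon.  Hence every further
    balloon adds 4 to the length and doubles mu.  The balloons of length 4, 5, 6
    and 7 that start the four iterations are 2413, 25314 and the balloons of 12
    and 132; their values -3, 4, -1 and 1 are non-zero.

    The proof of [mu_balloon] rests on corners.  A permutation of length at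
    least 2 has a corner when its first or last entry is its least or greatest
    value.  Adding a corner to l changes the sign of mu, unless l already has
    that corner, and then mu becomes 0 ([mu_add_corner]).  A sum of mu over
    permutations with a given corner is therefore minus a sum over permutations
    without it ([mu_sum_toggle]).

    Let l be contained in the balloon of b.  If a copy of l misses one of the
    four outer points, then l lies below one of four shells, each being b with
    three corners added; otherwise l is the balloon of some t <= b, where t may
    be empty ([le_balloon_cases]).  Toggling corners shows that mu has sum 0 over
    everything below some shell, with the exception b = 1, where the sum is -1
    ([mu_sum_below_shells]).  A balloon has no corner, so it is below some shell
    exactly when it is below b.  As mu has sum 0 below the balloon of b, what
    remains says, for b other than 1, that mu (balloon t) has sum 0 over those
    t <= b, including the empty one, whose balloon is not below b.  The missing t, those with
    balloon t <= b, contribute the sum of mu over all balloons below b.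
    Consequently the sum over 1 <= t <= b of

      mu (balloon t) - [t is a balloon] mu t - mu t

    does not depend on b ([sum_defect]), and a function whose sums over all
    intervals from 1 agree vanishes everywhere except at 1. *)

(** * Embeddings and the insertion of a point *)

(** Embeddings are stated for [m] and [n] possibly 0: the empty permutation is
    not a [permutation], but its balloon 2413 is one. *)
Definition emb m n (s : 'S_m) (p : 'S_n) (i : 'I_m -> 'I_n) : Prop :=
  {homo i : r t / (r < t)%N} /\ forall r t, (p (i r) < p (i t)) = (s r < s t).

Lemma emb_ltn m n (s : 'S_m) (p : 'S_n) i r t :
  emb s p i -> (i r < i t) = (r < t).
Proof.
case=> h _; case: (ltngtP r t) => [/h //|/h|/val_inj->]; last by rewrite ltnn.
by move=> /ltnW; rewrite leqNgt => /negbTE.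
Qed.

Lemma emb_inj m n (s : 'S_m) (p : 'S_n) i : emb s p i -> injective i.
Proof. by case=> /homo_ltn_inj. Qed.

Lemma emb_comp l m n (s : 'S_l) (p : 'S_m) (q : 'S_n) i j :
  emb s p i -> emb p q j -> emb s q (j \o i).
Proof.
move=> [i1 i2] [j1 j2]; split=> [r t rt|r t] /=; first by apply/j1/i1.
by rewrite j2 i2.
Qed.

Lemma lift_ltn n (u : 'I_n.+1) (k l : 'I_n) : (lift u k < lift u l) = (k < l).
Proof. by rewrite /= !ltnNge leq_bump2. Qed.

Lemma emb_lift n (s : 'S_n) u v : emb s (lift_perm u v s) (lift u).
Proof. by split=> [r t|r t]; rewrite ?lift_perm_lift lift_ltn. Qed.

(** Deleting the point at position [i]: [lift_perm] inserts a point at a given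
    position and value, and every permutation arises by putting back any one of
    its own points. *)
Lemma lift_perm_surj n (s : 'S_n.+1) i : exists s', s = lift_perm i (s i) s'.
Proof.
pose g k := odflt k (unlift (s i) (s (lift i k))).
have gE k : s (lift i k) = lift (s i) (g k).
  rewrite /g; case: unliftP => [j -> //|/perm_inj/esym/eqP].
  by rewrite (negbTE (neq_lift i k)).
have g_inj : injective g.
  by move=> k l e; apply/(@lift_inj _ i)/(@perm_inj _ s); rewrite !gE e.
exists (perm g_inj); apply/permP=> k; case: (unliftP i k) => [j|] ->.
  by rewrite lift_perm_lift permE gE.
by rewrite lift_perm_id.
Qed.

Lemma lift_perm_inj n (u v : 'I_n.+1) : injective (@lift_perm n u v).
Proof.
move=> s t e; apply/permP=> k; apply: (@lift_inj _ v).
by rewrite -!(lift_perm_lift u) e.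
Qed.

Lemma emb_drop m n (s : 'S_m) (p : 'S_n) u v i :
  emb s (lift_perm u v p) i -> (forall r, i r != u) ->
  exists2 j, emb s p j & forall r, i r = lift u (j r).
Proof.
move=> es miss.
have mid r : exists k, i r == lift u k.
  by case: (unliftP u (i r)) (miss r) => [k -> _|->]; [exists k | rewrite eqxx].
pose j r := xchoose (mid r).
have jE r : i r = lift u (j r) by apply/eqP; exact: (xchooseP (mid r)).
exists j => //; case: es => es1 es2; split=> [r t /es1|r t].
  by rewrite !jE lift_ltn.
by rewrite -es2 !jE !lift_perm_lift lift_ltn.
Qed.

(** When the inserted point is used, it comes from a point of [s], and what is
    left of [s] embeds in what is left of the larger permutation.  The last
    clause lets several deletions be chained. *)
Lemma emb_split m n (s : 'S_m.+1) (p : 'S_n) u v i r :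
  emb s (lift_perm u v p) i -> i r = u ->
  exists s' j, [/\ s = lift_perm r (s r) s', emb s' p j
                 & forall k, i (lift r k) = lift u (j k)].
Proof.
move=> es ir; have [s' e] := lift_perm_surj s r.
have es' : emb s' (lift_perm u v p) (i \o lift r).
  by apply: emb_comp es; rewrite [in X in emb _ X _]e; apply: emb_lift.
have [j ej jE] : exists2 j, emb s' p j & forall k, (i \o lift r) k = lift u (j k).
  apply: (emb_drop es') => k /=; rewrite -ir (inj_eq (emb_inj es)).
  by rewrite eq_sym neq_lift.
by exists s', j.
Qed.

Definition extend m n (u : 'I_m.+1) (u' : 'I_n.+1) (i : 'I_m -> 'I_n) k :=
  if unlift u k is Some k' then lift u' (i k') else u'.

Lemma extend_lift m n (u : 'I_m.+1) (u' : 'I_n.+1) i k :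
  extend u u' i (lift u k) = lift u' (i k).
Proof. by rewrite /extend liftK. Qed.

Lemma extend_id m n (u : 'I_m.+1) (u' : 'I_n.+1) i : extend u u' i u = u'.
Proof. by rewrite /extend unlift_none. Qed.

Lemma ltn_lift_l n (u : 'I_n.+1) k : (u < lift u k) = (u <= k).
Proof. by rewrite /= /bump; lia. Qed.

Lemma ltn_lift_r n (u : 'I_n.+1) k : (lift u k < u) = (k < u).
Proof. by rewrite /= /bump; lia. Qed.

(** The two conditions say that both new points are inserted at matching places:
    [lift u] moves exactly the indices [k] with [u <= k]. *)
Lemma emb_extend m n (s : 'S_m) (p : 'S_n) (u v : 'I_m.+1) (u' v' : 'I_n.+1) i :
  emb s p i -> (forall k, (u' <= i k) = (u <= k)) ->
  (forall k, (v' <= p (i k)) = (v <= s k)) ->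
  emb (lift_perm u v s) (lift_perm u' v' p) (extend u u' i).
Proof.
move=> es cu cv; have lt := emb_ltn _ _ es; split=> r t; last first.
  case: (unliftP u r) => [r'|] ->; case: (unliftP u t) => [t'|] ->;
    rewrite ?extend_lift ?extend_id ?lift_perm_lift ?lift_perm_id ?ltnn //.
  - by rewrite !lift_ltn; case: es.
  - by rewrite !ltn_lift_r !ltnNge cv.
  - by rewrite !ltn_lift_l.
case: (unliftP u r) => [r'|] ->; case: (unliftP u t) => [t'|] ->;
  rewrite ?extend_lift ?extend_id ?ltnn //.
- by rewrite !lift_ltn lt.
- by rewrite !ltn_lift_r !ltnNge cu.
- by rewrite !ltn_lift_l cu.
Qed.

(** Two points may be inserted in either order.  The first and third hypotheses
    give the final place of the inner point, the other two that of the outer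
    one. *)
Lemma lift_permC n (s : 'S_n)
    (u1 v1 u1' v1' : 'I_n.+2) (u2 v2 u2' v2' : 'I_n.+1) :
  u1' = lift u1 u2 -> u1 = lift u1' u2' ->
  v1' = lift v1 v2 -> v1 = lift v1' v2' ->
  lift_perm u1 v1 (lift_perm u2 v2 s) = lift_perm u1' v1' (lift_perm u2' v2' s).
Proof.
have liftC (a a' : 'I_n.+2) (b b' : 'I_n.+1) k :
    a' = lift a b -> a = lift a' b' -> lift a (lift b k) = lift a' (lift b' k).
  move=> /(congr1 val)/= e1 /(congr1 val)/= e2; apply/val_inj => /=.
  by move: e1 e2; rewrite /bump; lia.
move=> eu1 eu2 ev1 ev2; apply/permP=> k; case: (unliftP u1 k) => [k'|] ->.
  rewrite lift_perm_lift; case: (unliftP u2 k') => [k''|] ->.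
    rewrite lift_perm_lift (liftC _ _ _ _ _ eu1 eu2) !lift_perm_lift.
    exact: liftC.
  by rewrite lift_perm_id -eu1 lift_perm_id.
by rewrite lift_perm_id {1}eu2 lift_perm_lift lift_perm_id.
Qed.

(** * Corners *)

Lemma le_embP (s p : permutation) :
  reflect (exists i, emb (tagged s) (tagged p) i) (s <= p)%O.
Proof. exact: containedP. Qed.

Lemma emb_le m n (s : 'S_m.+1) (p : 'S_n.+1) i :
  emb s p i -> (perm_of s <= perm_of p)%O.
Proof. by move=> e; apply/le_embP; exists i. Qed.

Lemma le_one (l : permutation) : tag l = 0 -> forall m : permutation, (l <= m)%O.
Proof.
case: l => n l /= en; case: _ / (esym en) l => l m.
apply/le_embP; exists (fun=> ord0); split=> r t /=; rewrite !ord1 ?ltnn //.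
Qed.

Lemma one_le (m : permutation) : (one <= m)%O.
Proof. exact: le_one. Qed.

Lemma tag_eq0 (l : permutation) : tag l = 0 -> l = one.
Proof.
by move=> h; apply: le_anti; rewrite one_le le_one.
Qed.

Definition extreme n (b : bool) : 'I_n.+1 := if b then ord_max else ord0.

Lemma extreme_eq n b c : (extreme n.+1 b == extreme n.+1 c) = (b == c).
Proof. by case: b; case: c; rewrite ?eqxx. Qed.

Lemma lift_extreme n b :
  lift (extreme n.+1 (~~ b)) (extreme n b) = extreme n.+1 b.
Proof. by case: b; apply/val_inj; rewrite //= /bump ltnn. Qed.

Lemma lift_extremeN n b :
  lift (extreme n.+1 b) (extreme n (~~ b)) = extreme n.+1 (~~ b).
Proof. by rewrite -[X in lift (extreme _ X)](negbK b) lift_extreme. Qed.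

(** A corner is a side for the position (false for left) and a side for the value
    (false for low).  [turn] is the clockwise quarter turn of the picture. *)
Definition corner := (bool * bool)%type.
Definition flip (x : corner) : corner := (~~ x.1, ~~ x.2).
Definition turn (x : corner) : corner := (x.2, ~~ x.1).

Definition add_corner (x : corner) (l : permutation) : permutation :=
  perm_of (lift_perm (extreme _ x.1) (extreme _ x.2) (tagged l)).

(** The permutation 1 is taken to have no corner.  With this convention mu
    changes sign when a corner is added to it, and a permutation never has two
    corners that are adjacent in the sense of [turn]. *)
Definition has_corner (x : corner) (l : permutation) : bool :=
  (0 < tag l) && (tagged l (extreme _ x.1) == extreme _ x.2).

Lemma length_add_corner x l : length (add_corner x l) = (length l).+1.
Proof. by []. Qed.

Lemma has_add_corner x l : has_corner x (add_corner x l).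
Proof. by rewrite /has_corner /= lift_perm_id. Qed.

Lemma has_cornerP x l :
  reflect (exists l', l = add_corner x l') (has_corner x l).
Proof.
apply: (iffP idP) => [|[l' ->]]; last exact: has_add_corner.
case: l => [[|n] l] // /andP[_ /= /eqP e].
have [l' le] := lift_perm_surj l (extreme _ x.1).
by exists (perm_of l'); rewrite /add_corner /= -e -le.
Qed.

Lemma has_corner_one x : has_corner x one = false. Proof. by []. Qed.

Lemma perm_of_inj n : injective (@perm_of n).
Proof. by move=> p q; apply: eq_from_Tagged. Qed.

Lemma add_corner_inj x : injective (add_corner x).
Proof.
move=> l m e; have := congr1 (@tag _ _) e => /= -[].
case: l m e => [k l] [n m] /= e ekn; case: _ / ekn m e => m.
by move=> /(@perm_of_inj _ _ _)/lift_perm_inj /= ->.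
Qed.

Lemma has_corner_turn x l : has_corner x l -> ~~ has_corner (turn x) l.
Proof.
case: x => p v; case: l => [[|n] l] // /andP[_ /= /eqP e].
rewrite /has_corner /=; case: (eqVneq v p) e => [<-|vp] e.
  by rewrite e extreme_eq; case: v {e}.
have -> : ~~ p = v by case: p v vp {e} => [] [].
by rewrite -[X in _ != X]e (inj_eq perm_inj) extreme_eq.
Qed.

Lemma turn_turn x : turn (turn x) = flip x. Proof. by case: x. Qed.
Lemma flipK x : flip (flip x) = x.
Proof. by case: x => p v; rewrite /flip /= !negbK. Qed.

(** The exception comes from 12 and 21, which arise from 1 by adding either one
    of two opposite corners. *)
Lemma has_flip_corner x l :
  has_corner (flip x) (add_corner x l) = has_corner (flip x) l || (l == one).
Proof.
case: l => [[|n] l].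
  have -> : existT _ 0 l == one by apply/eqP/tag_eq0.
  rewrite /has_corner /=.
  have -> : extreme 1 (~~ x.1) = lift (extreme 1 x.1) ord0 by case: x.1; apply/val_inj.
  rewrite lift_perm_lift ord1.
  by apply/eqP; case: x.2; apply/val_inj.
have -> : (existT _ n.+1 l == one) = false.
  by apply/eqP => /(congr1 (@tag _ _)).
rewrite orbF /has_corner /=.
rewrite -(lift_extremeN n.+1 x.1) -(lift_extremeN n.+1 x.2) lift_perm_lift.
by rewrite (inj_eq (@lift_inj _ _)).
Qed.

Lemma add_cornerC x l :
  add_corner (flip x) (add_corner x l) = add_corner x (add_corner (flip x) l).
Proof.
by congr perm_of; apply: lift_permC; rewrite ?lift_extreme ?lift_extremeN.
Qed.

Lemma emb_extreme m n (s : 'S_m.+1) (p : 'S_n.+1) i r b :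
  emb s p i -> i r = extreme _ b -> r = extreme _ b.
Proof.
move=> es; have lt := emb_ltn _ _ es; case: b => /= ir; apply/val_inj/eqP.
  have := lt r ord_max; rewrite ir ltnNge leq_ord /= => /esym/negbT.
  by rewrite -leqNgt; have := leq_ord r; rewrite eqn_leq => -> ->.
by have := lt ord0 r; rewrite ir ltn0 => /esym/negbT; rewrite -eqn0Ngt.
Qed.

Lemma emb_extreme_val m n (s : 'S_m.+1) (p : 'S_n.+1) i r b :
  emb s p i -> p (i r) = extreme _ b -> s r = extreme _ b.
Proof.
case=> _ es; case: b => /= ir; apply/val_inj/eqP.
  have := es r ((s^-1)%g ord_max); rewrite ir ltnNge leq_ord permKV /=.
  move=> /esym/negbT; rewrite -leqNgt; have := leq_ord (s r).
  by rewrite eqn_leq => -> ->.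
have := es ((s^-1)%g ord0) r; rewrite ir ltn0 permKV => /esym/negbT.
by rewrite -eqn0Ngt.
Qed.

(** Only an extreme point of [l] can be sent to the added corner, and it would be
    a corner of [l] of the same kind, or [l] has a single point. *)
Lemma le_add_corner_none x l m : ~~ has_corner x l ->
  (l <= add_corner x m)%O = (l <= m)%O.
Proof.
move=> nx; apply/idP/idP => [/le_embP[i ei]|lm].
  case: (boolP [exists r, i r == extreme _ x.1]) => [/existsP[r /eqP ir]|]; last first.
    rewrite negb_exists => /forallP miss.
    by have [j ej _] := emb_drop ei miss; apply/le_embP; exists j.
  apply: le_one; apply/eqP; move: nx; rewrite /has_corner.
  case: (tag l =P 0) => // /eqP; rewrite -lt0n => -> /negP[]; apply/eqP.
  rewrite -(emb_extreme ei ir); apply: (emb_extreme_val ei).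
  by rewrite ir lift_perm_id.
apply: le_trans lm _; exact/emb_le/emb_lift.
Qed.

Lemma le_add_corner2 x l m : (add_corner x l <= add_corner x m)%O = (l <= m)%O.
Proof.
apply/idP/idP => /le_embP[i ei].
  have ei' := emb_comp (emb_lift (tagged l) _ _) ei.
  have [|j ej _] := emb_drop ei'; last by apply/le_embP; exists j.
  move=> r; apply/eqP => /= /(emb_extreme ei)/eqP.
  by rewrite eq_sym (negbTE (neq_lift _ _)).
have side n b (k : 'I_n) : (extreme n b <= k) = ~~ b.
  by case: b; rewrite //= leqNgt ltn_ord.
have e : emb (tagged (add_corner x l)) (tagged (add_corner x m))
             (extend (extreme _ x.1) (extreme _ x.1) i).
  by apply: emb_extend => // k; rewrite !side.
by apply/le_embP; eexists; exact: e.
Qed.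

Lemma le_add_corner x m : (m <= add_corner x m)%O.
Proof. exact/emb_le/emb_lift. Qed.

Lemma le_add_cornerW x l m : (add_corner x l <= m)%O -> (l <= m)%O.
Proof. exact/le_trans/le_add_corner. Qed.

(** * Sums of the Moebius function *)

(** All sums range over one list of bounded length, so that they can be compared
    and reindexed; the predicates that select the terms bound the length
    anyway. *)
Definition upto (N : nat) : seq permutation :=
  [seq perm_of l | k <- iota 0 N, l <- enum 'S_k.+1].

Lemma mem_upto N l : (l \in upto N) = (length l <= N).
Proof.
apply/allpairsPdep/idP => [[k [q [kN _ ->]]]|lN].
  by rewrite mem_iota in kN.
by case: l lN => k q kN; exists k, q; rewrite mem_iota mem_enum.
Qed.

Lemma uniq_upto N : uniq (upto N).
Proof.
apply: allpairs_uniq_dep; first exact: iota_uniq.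
  by move=> k _; exact: enum_uniq.
by move=> [k q] [k' q'] _ _ /=.
Qed.

Local Open Scope ring_scope.

Lemma sum_upto N (P : pred permutation) (F : permutation -> int) :
  \sum_(l <- upto N | P l) F l =
  \sum_(k < N) \sum_(l : 'S_k.+1 | P (perm_of l)) F (perm_of l).
Proof.
rewrite big_mkcond big_allpairs_dep -{1}(subn0 N) -/(index_iota 0 N) big_mkord.
by apply: eq_bigr => k _; rewrite big_enum [RHS]big_mkcond.
Qed.

Definition mu (l : permutation) : int := mobius one l.

Lemma sum_upto_eq1 N (F : permutation -> int) p : (length p <= N)%N ->
  \sum_(l <- upto N | l == p) F l = F p.
Proof.
move=> pN; rewrite -big_filter (filter_pred1_uniq (uniq_upto N)) ?big_seq1 //.
by rewrite mem_upto.
Qed.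

Definition mu_sum N (P : pred permutation) : int :=
  \sum_(l <- upto N | P l) mu l.

Lemma eq_mu_sum N (P Q : pred permutation) : P =1 Q -> mu_sum N P = mu_sum N Q.
Proof. by move=> PQ; apply: eq_bigl. Qed.

Lemma mu_sum_split N (Q P : pred permutation) :
  mu_sum N P =
  mu_sum N (fun l => Q l && P l) + mu_sum N (fun l => ~~ Q l && P l).
Proof.
by rewrite /mu_sum (bigID Q) /=; congr (_ + _); apply: eq_bigl => l; rewrite andbC.
Qed.

Lemma mu_sum_eq1 N p : (length p <= N)%N -> mu_sum N (pred1 p) = mu p.
Proof. exact: sum_upto_eq1. Qed.

(** Reindexing along an injection [h] with image [Q] that does not decrease
    lengths. *)
Lemma sum_upto_image N (h : permutation -> permutation) (Q P : pred permutation)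
    (F : permutation -> int) :
  injective h -> (forall l, length l <= length (h l))%N ->
  (forall l, reflect (exists l', l = h l') (Q l)) ->
  (forall l, P l -> length l <= N)%N ->
  \sum_(l <- upto N | Q l && P l) F l = \sum_(l <- upto N | P (h l)) F (h l).
Proof.
move=> h_inj hlen QP PN; rewrite -(big_map h P) -[LHS]big_filter -[RHS]big_filter.
apply: perm_big; apply: uniq_perm.
- exact/filter_uniq/uniq_upto.
- by rewrite filter_uniq // map_inj_uniq // uniq_upto.
move=> l; rewrite !mem_filter mem_upto [Q l && _]andbC -andbA; case Pl: (P l) => //=.
rewrite PN // andbT; apply/QP/mapP => [[l' e]|[l' _ e]]; last by exists l'.
by exists l' => //; rewrite mem_upto (leq_trans (hlen _)) // -e PN.
Qed.

Lemma mu_one : mu one = 1. Proof. exact: mobius_refl. Qed.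

Lemma le_length (l m : permutation) : (l <= m)%O -> (length l <= length m)%N.
Proof. exact: contained_length. Qed.

Lemma mu_sum_le N p : (length p <= N)%N ->
  mu_sum N (fun l => l <= p)%O = (p == one)%:R.
Proof.
move=> pN.
have -> : mu_sum N (fun l => l <= p)%O = mu_sum (length p) (fun l => l <= p)%O.
  rewrite /mu_sum -[LHS]big_filter -[RHS]big_filter; apply: perm_big.
  apply: uniq_perm; rewrite ?filter_uniq ?uniq_upto // => l; rewrite !mem_filter !mem_upto.
  case: (boolP (l <= p)%O) => //= lp.
  by rewrite (le_length lp) (leq_trans (le_length lp) pN).
case: (eqVneq p one) => [->|np].
  rewrite -mu_one -[RHS](@mu_sum_eq1 (length one)) //; apply: eq_mu_sum => l /=.
  apply/idP/eqP => [l1|-> //].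
  by apply: le_anti; rewrite l1 one_le.
have lt1 : (one < p)%O by rewrite lt_neqAle one_le eq_sym np.
rewrite (@mu_sum_split _ (pred1 p)) (@eq_mu_sum _ _ (pred1 p)); last first.
  by move=> l /=; case: eqP => // ->; rewrite lexx.
rewrite mu_sum_eq1 // /mu (mobius_lt lt1) /mu_sum sum_upto addrC.
apply/eqP; rewrite subr_eq0; apply/eqP; apply: eq_bigr => k _.
by apply: eq_bigl => l; rewrite one_le lt_neqAle.
Qed.

Lemma mu_sum_corner N x (P : pred permutation) :
  (forall l, P l -> length l <= N)%N ->
  mu_sum N (fun l => has_corner x l && P l) =
  \sum_(l <- upto N | P (add_corner x l)) mu (add_corner x l).
Proof.
move=> PN; apply: sum_upto_image PN => //; first exact: add_corner_inj.
exact: has_cornerP.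
Qed.

(** The permutations below [add_corner x l] are the [m <= l] without corner [x]
    and the [add_corner x m] with [m <= l].  By induction on the length, all
    their values cancel in pairs m, [add_corner x m], or are 0, except for the
    one of [add_corner x l] and, if [l] has no corner [x], the one of [l]. *)
Lemma mu_add_corner x l :
  mu (add_corner x l) = if has_corner x l then 0 else - mu l.
Proof.
have [b lb] := ubnP (length l); elim: b l lb => // b IH l lb.
have := @mu_sum_le (length l).+1 (add_corner x l) (leqnn _).
have -> : (add_corner x l == one) = false by apply/eqP => /(congr1 length).
have bnd m : (m <= add_corner x l)%O -> (length m <= (length l).+1)%N.
  by move/le_length.
(* The value claimed for [mu (add_corner x m)]. *)
pose g m := if has_corner x m then 0 else - mu m.
have corr : \sum_(m <- upto (length l).+1 | (m <= l)%O) (mu (add_corner x m) - g m)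
            = mu (add_corner x l) - g l.
  rewrite (bigID (pred1 l)) /= [X in _ + X]big1 ?addr0 => [|m /andP[ml nml]].
    rewrite -[RHS](@sum_upto_eq1 (length l).+1 (fun m => mu (add_corner x m) - g m) l) //.
    apply: eq_bigl => m.
    by case: eqP => [->|]; rewrite ?lexx ?andbF.
  apply/eqP; rewrite subr_eq0 /g; apply/eqP/IH.
  rewrite -ltnS (leq_trans _ lb) // ltnS.
  by apply: perm_lt_length; rewrite lt_neqAle nml.
rewrite (@mu_sum_split _ (has_corner x)) mu_sum_corner //.
under eq_bigl do rewrite le_add_corner2.
rewrite (eq_bigr (fun m => (mu (add_corner x m) - g m) + g m)); last first.
  by move=> m _; rewrite subrK.
rewrite big_split /= corr.
have -> : \sum_(m <- upto (length l).+1 | (m <= l)%O) g m =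
          - mu_sum (length l).+1 (fun m => ~~ has_corner x m && (m <= add_corner x l)%O).
  rewrite /mu_sum -sumrN (bigID (has_corner x)) /= big1 ?add0r; last first.
    by move=> m /andP[_ xm]; rewrite /g xm.
  rewrite [LHS]big_mkcond [RHS]big_mkcond; apply: eq_bigr => m _.
  case xm: (has_corner x m); rewrite /= ?andbF ?andbT //.
  by rewrite le_add_corner_none ?xm // /g xm.
by move=> /eqP; rewrite subrK subr_eq0 => /eqP.
Qed.

(** The main tool below: after the corner is removed, the terms that had it
    twice vanish. *)
Lemma mu_sum_toggle N x (P : pred permutation) :
  (forall l, P l -> length l <= N)%N ->
  mu_sum N (fun l => has_corner x l && P l) =
  - mu_sum N (fun l => ~~ has_corner x l && P (add_corner x l)).
Proof.
move=> PN; rewrite mu_sum_corner // /mu_sum -sumrN (bigID (has_corner x)) /= big1 ?add0r.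
  rewrite (eq_bigl (fun l => ~~ has_corner x l && P (add_corner x l))).
    by apply: eq_bigr => l /andP[nx _]; rewrite mu_add_corner (negbTE nx).
  by move=> l; rewrite andbC.
by move=> l /andP[_ xl]; rewrite mu_add_corner xl.
Qed.

(** * The permutations below a shell *)

(** The balloon of [b] without one of its four outer points.  The three points
    left can be peeled off as corners, in the clockwise order [x], [turn x],
    [flip x]. *)
Definition shell (x : corner) (b : permutation) : permutation :=
  add_corner x (add_corner (turn x) (add_corner (flip x) b)).

Definition below_shells (b l : permutation) : bool :=
  [exists x : corner, (l <= shell x b)%O].

Lemma has_corner_turnN x l : has_corner (turn x) l -> ~~ has_corner x l.
Proof. by apply: contraL => /has_corner_turn. Qed.

Lemma corner_cases (x y : corner) :
  [\/ y = x, y = turn x, y = flip x | y = turn (flip x)].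
Proof.
case: x y => [[] []] [[] []];
  by [apply: Or41 | apply: Or42 | apply: Or43 | apply: Or44].
Qed.

(** The shell that starts with [x] subsumes the other three here.  A permutation
    with corner [x] has neither of the corners adjacent to [x], so these drop
    out of the other shells, and what is left of them is smaller once [x] is
    peeled off. *)
Lemma below_shells_add_corner x l b : ~~ has_corner x l ->
  below_shells b (add_corner x l) =
  (l <= add_corner (turn x) (add_corner (flip x) b))%O.
Proof.
move=> xl; apply/existsP/idP => [[y]|lb]; last by exists x; rewrite le_add_corner2.
have nt m : ~~ has_corner (turn x) (add_corner x m)
  by apply/has_corner_turn/has_add_corner.
have no m : ~~ has_corner (turn (flip x)) (add_corner x m).
  have := @has_corner_turn (turn (flip x)) (add_corner x m).
  rewrite turn_turn flipK has_add_corner.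
  by move=> h; apply/negP => /h.
have le_ob :
  (add_corner (flip x) b <= add_corner (turn x) (add_corner (flip x) b))%O by exact: le_add_corner.
have le_bo : (b <= add_corner (flip x) b)%O by exact: le_add_corner.
have peel m : (add_corner x m <= add_corner (turn (flip x)) b)%O ||
              (add_corner x m <= add_corner (turn (flip x)) (add_corner x b))%O ->
    (m <= b)%O.
  rewrite !(le_add_corner_none _ (no m)) => /orP[/le_add_cornerW //|].
  by rewrite le_add_corner2.
(* The shells starting with [turn x] and with [flip x] are treated at once:
   after their inessential parts are dropped, they have the form below, with
   [c] equal to [b] or to [add_corner x b]. *)
have main c : ((c == b) || (c == add_corner x b)) ->
    (add_corner x l <= add_corner (flip x) (add_corner (turn (flip x)) c))%O ->
    (l <= add_corner (turn x) (add_corner (flip x) b))%O.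
  move=> cE.
  have peelc m : (add_corner x m <= add_corner (turn (flip x)) c)%O -> (m <= b)%O.
    by move=> h; apply: peel; case/orP: cE h => /eqP -> ->; rewrite ?orbT.
  case: (boolP (has_corner (flip x) (add_corner x l))) => [|nd]; last first.
    rewrite (le_add_corner_none _ nd) => /peelc lb.
    exact: (le_trans lb (le_trans le_bo _)).
  rewrite has_flip_corner => /orP[/has_cornerP[l' ->]|/eqP -> _];
    last exact: one_le.
  rewrite -add_cornerC le_add_corner2 => /peelc lb.
  by apply: le_trans le_ob; rewrite le_add_corner2.
case: (corner_cases x y) => ->; rewrite /shell.
- by rewrite le_add_corner2.
- rewrite turn_turn (le_add_corner_none _ (nt _)).
  have -> : flip (turn x) = turn (flip x) by case: (x).
  by apply: main; rewrite eqxx.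
- by rewrite flipK; apply: main; rewrite eqxx orbT.
- rewrite (le_add_corner_none _ (no _)) turn_turn flipK le_add_corner2.
  have -> : flip (turn (flip x)) = turn x by case: (x) => [[] []].
  by move=> h; apply: le_trans h _; rewrite le_add_corner2.
Qed.

Lemma below_shells_none l b : (forall x, ~~ has_corner x l) ->
  below_shells b l = (l <= b)%O.
Proof.
move=> nl; apply/existsP/idP => [[y]|lb]; first by rewrite /shell !le_add_corner_none.
by exists (false, false); rewrite /shell !le_add_corner_none.
Qed.

Lemma length_below_shells b l :
  below_shells b l -> (length l <= length b + 3)%N.
Proof. by case/existsP => x /le_length; rewrite !length_add_corner !addnS addn0. Qed.

Lemma has_corner_flip x l :
  has_corner x (add_corner (flip x) l) = has_corner x l || (l == one).
Proof. by have := has_flip_corner (flip x) l; rewrite flipK. Qed.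

Lemma mu_sum_one N (P : pred permutation) :
  (0 < N)%N -> P =1 pred1 one -> mu_sum N P = 1.
Proof. by move=> N0 /eq_mu_sum ->; rewrite mu_sum_eq1 ?mu_one. Qed.

(** In a balloon, [below_shells b] describes the permutations that need at most
    three of the four outer points. *)
Section Star.
Variables (b : permutation) (N : nat).
Hypothesis bN : (length b + 3 <= N)%N.
Let N0 : (0 < N)%N. Proof. by move: bN; rewrite addnS; apply: leq_trans. Qed.

Let bnd3 l : below_shells b l -> (length l <= N)%N.
Proof. by move/length_below_shells => h; apply: leq_trans h bN. Qed.
Let bnd2 x y l : (l <= add_corner x (add_corner y b))%O -> (length l <= N)%N.
Proof. by move/le_length; rewrite !length_add_corner; move: bN; lia. Qed.
Let bnd1 x l : (l <= add_corner x b)%O -> (length l <= N)%N.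
Proof. by move/le_length; rewrite !length_add_corner; move: bN; lia. Qed.

(** Toggling [x], then [turn x], then [flip x] peels the shell that starts with
    [x]; at each stage the terms pair off, and the last pairing leaves a single
    term: 12 or 21, whose value is -1, is both [add_corner x one] and
    [add_corner (flip x) one]. *)
Lemma mu_sum_corner_shells x :
  mu_sum N (fun l => has_corner x l && below_shells b l) = -1.
Proof.
rewrite mu_sum_toggle //.
rewrite (@eq_mu_sum _ _ (fun l => ~~ has_corner x l &&
   (l <= add_corner (turn x) (add_corner (flip x) b))%O)); last first.
  move=> l; case: (boolP (has_corner x l)) => //= nx.
  by rewrite below_shells_add_corner.
set b' := add_corner (flip x) b.
have step :
    mu_sum N (fun l => ~~ has_corner x l && (l <= add_corner (turn x) b')%O) =
            - mu_sum N (fun l => has_corner x l && (l <= b')%O).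
  rewrite (@mu_sum_split _ (has_corner (turn x))).
  rewrite (@eq_mu_sum _ _ (fun l =>
    has_corner (turn x) l && (l <= add_corner (turn x) b')%O)); last first.
    move=> l; case: (boolP (has_corner (turn x) l)) => //= tl.
    by rewrite (has_corner_turnN tl).
  rewrite mu_sum_toggle; last by move=> l; apply: bnd2.
  rewrite (@eq_mu_sum _ _ (fun l => ~~ has_corner (turn x) l && (l <= b')%O));
    last first.
    by move=> l; rewrite le_add_corner2.
  rewrite (@mu_sum_split _ (has_corner x)) opprD.
  rewrite (@eq_mu_sum _ (fun l => _ && (_ && (_ <= add_corner _ _)%O))
    (fun l => ~~ has_corner x l && (~~ has_corner (turn x) l && (l <= b')%O))); last first.
    move=> l; rewrite andbCA; case: (has_corner x l) => //=.
    case: (boolP (has_corner (turn x) l)) => //= nt.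
    by rewrite le_add_corner_none.
  rewrite subrK; congr (- _); apply: eq_mu_sum => l.
  by case: (boolP (has_corner x l)) => //= /has_corner_turn ->.
rewrite step opprK (@mu_sum_split _ (has_corner (flip x))).
rewrite mu_sum_toggle; last by move=> l /andP[_]; apply: bnd1.
rewrite (@eq_mu_sum _ _ (fun l => ~~ has_corner (flip x) l &&
    ((has_corner x l || (l == one)) && (l <= b)%O)));
  last by move=> l; rewrite le_add_corner2 has_corner_flip.
rewrite (@mu_sum_split _ (pred1 one)) opprD (mu_sum_one N0); last first.
  move=> l /=; case: eqP => //= ->.
  by rewrite !has_corner_one one_le.
rewrite (@eq_mu_sum _ (fun l => _ && (_ && (_ <= add_corner _ _)%O)) (fun l =>
    ~~ pred1 one l && (~~ has_corner (flip x) l &&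
      ((has_corner x l || (l == one)) && (l <= b)%O)))).
  by rewrite subrK.
move=> l /=; case: (l =P one) => [->|_] /=; rewrite ?has_corner_one // orbF.
by case: (boolP (has_corner (flip x) l)) => //= nf; rewrite le_add_corner_none.
Qed.

(** Removing both corners, one after the other, leads to the terms on the right
    with sign +1.  The correction is due to 1 twice: it is a term on the right
    from which no permutation with both corners arises by two additions, and a
    single addition already gives 12 or 21, which has both corners and the value
    -1. *)
Lemma mu_sum_two_corners x :
  mu_sum N (fun l =>
    has_corner x l && (has_corner (flip x) l && below_shells b l)) =
  mu_sum N (fun l =>
    ~~ has_corner x l && (~~ has_corner (flip x) l && (l <= b)%O)) - 2.
Proof.
rewrite mu_sum_toggle; last by move=> l /andP[_]; apply: bnd3.
rewrite (@eq_mu_sum _ _ (fun l =>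
   ~~ has_corner x l && ((has_corner (flip x) l || (l == one)) &&
   (l <= add_corner (turn x) (add_corner (flip x) b))%O))); last first.
  move=> l; case: (boolP (has_corner x l)) => //= nx.
  by rewrite below_shells_add_corner // has_flip_corner.
rewrite (@mu_sum_split _ (pred1 one)) (mu_sum_one N0); last first.
  by move=> l /=; case: eqP => //= ->; rewrite !has_corner_one one_le.
rewrite (@eq_mu_sum _ _ (fun l => has_corner (flip x) l && (~~ has_corner x l &&
   (l <= add_corner (turn x) (add_corner (flip x) b))%O))); last first.
  move=> l /=; case: (l =P one) => [->|_] /=; rewrite ?has_corner_one // orbF.
  by rewrite andbCA.
rewrite mu_sum_toggle; last by move=> l /andP[_]; apply: bnd2.
rewrite (@eq_mu_sum _ _ (fun l =>
   ~~ pred1 one l && (~~ has_corner x l && (~~ has_corner (flip x) l && (l <= b)%O)))); last first.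
  move=> l; rewrite has_corner_flip negb_or le_add_corner_none; last first.
    by apply: has_corner_turnN; rewrite turn_turn has_add_corner.
  rewrite le_add_corner2 /=; case: (l =P one) => [->|_]; rewrite /= ?andbF ?andbT //.
  by rewrite andbCA.
rewrite [in RHS](@mu_sum_split _ (pred1 one)).
rewrite [X in _ = X + _ - _](mu_sum_one N0); last first.
  by move=> l /=; case: eqP => //= ->; rewrite !has_corner_one one_le.
ring.
Qed.

Lemma mu_sum_opposite_corners x :
  mu_sum N (fun l =>
    (has_corner x l || has_corner (flip x) l) && below_shells b l) =
  mu_sum N (fun l =>
    (has_corner x l || has_corner (flip x) l) && (l <= b)%O) - (b == one)%:R.
Proof.
have bN' : (length b <= N)%N by move: bN; lia.
have := mu_sum_corner_shells (flip x).
rewrite (@mu_sum_split _ (has_corner x)) mu_sum_two_corners => e2.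
rewrite (@mu_sum_split _ (has_corner x)).
rewrite (@eq_mu_sum _ _ (fun l => has_corner x l && below_shells b l)); last first.
  by move=> l; case: (has_corner x l).
rewrite mu_sum_corner_shells.
rewrite (@eq_mu_sum _ _ (fun l =>
    ~~ has_corner x l && (has_corner (flip x) l && below_shells b l)));
  last by move=> l; case: (has_corner x l).
have := mu_sum_le bN'.
rewrite (@mu_sum_split _ (fun l => has_corner x l || has_corner (flip x) l)).
rewrite (@eq_mu_sum _ (fun l => ~~ _ && _)
  (fun l => ~~ has_corner x l && (~~ has_corner (flip x) l && (l <= b)%O))); last first.
  by move=> l; rewrite negb_or andbA.
move=> <-; move: e2; set S := mu_sum _ _; set Z := mu_sum _ _ => e2.
have -> : Z = -1 - (S - 2) by rewrite -e2; ring.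
ring.
Qed.

(** Adjacent corners exclude each other, so the sum splits into the permutations
    with a corner on one diagonal, those with a corner on the other diagonal,
    and those without corners.  The last ones are below a shell exactly when
    they are below [b], and each diagonal contributes the same as for the
    interval up to [b], up to the correction [b == one]. *)
Lemma mu_sum_below_shells : mu_sum N (below_shells b) = - (b == one)%:R.
Proof.
have bN' : (length b <= N)%N by move: bN; lia.
pose ad l := has_corner (false, false) l || has_corner (true, true) l.
pose bc l := has_corner (false, true) l || has_corner (true, false) l.
have excl l : bc l -> ~~ ad l.
  rewrite /ad negb_or => /orP[] h.
    by rewrite (@has_corner_turnN (false, false)) //=
               (@has_corner_turn (false, true)).
  by rewrite (@has_corner_turnN (true, true)) ?andbT //=
             (@has_corner_turn (true, false)).
have cut P : mu_sum N P =
    mu_sum N (fun l => ad l && P l) + mu_sum N (fun l => bc l && P l) +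
    mu_sum N (fun l => ~~ ad l && (~~ bc l && P l)).
  rewrite (@mu_sum_split _ ad P).
  rewrite (@mu_sum_split _ bc (fun l => ~~ ad l && _)) addrA.
  congr (_ + _ + _); apply: eq_mu_sum => l; last by rewrite andbCA.
  by case: (boolP (bc l)) => //= /excl ->.
rewrite (cut (below_shells b)).
rewrite (mu_sum_opposite_corners (false, false)).
rewrite (mu_sum_opposite_corners (false, true)).
have := mu_sum_le bN'; rewrite (cut (fun l => l <= b)%O) => e.
rewrite (@eq_mu_sum _ (fun l => ~~ ad l && (~~ bc l && _))
  (fun l => ~~ ad l && (~~ bc l && (l <= b)%O))); last first.
  move=> l; case: (boolP (ad l)) => //=; case: (boolP (bc l)) => //=.
  rewrite !negb_or => /andP[n1 n2] /andP[n3 n4]; apply: below_shells_none.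
  by case=> [] [] [].
by rewrite -e; ring.
Qed.
End Star.

(** * Balloons *)

Local Close Scope ring_scope.

Definition second n : 'I_n.+2 := lift ord0 ord0.
Definition penult n : 'I_n.+2 := lift ord_max ord_max.

Lemma val_second n : second n = 1 :> nat. Proof. by []. Qed.
Lemma val_penult n : penult n = n :> nat. Proof. by rewrite /= /bump ltnn. Qed.

Definition raw_balloon n (s : 'S_n) : 'S_n.+4 :=
  lift_perm ord0 (second _) (lift_perm ord0 ord_max
    (lift_perm ord_max ord_max (lift_perm ord_max ord0 s))).

Definition raw_shell n (x : corner) (s : 'S_n) : 'S_n.+3 :=
  lift_perm (extreme _ x.1) (extreme _ x.2)
    (lift_perm (extreme _ (turn x).1) (extreme _ (turn x).2)
      (lift_perm (extreme _ (flip x).1) (extreme _ (flip x).2) s)).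

(** Position and value of the outer point of a balloon that [shell x] lacks; it
    is the corner that precedes [x] clockwise, moved inwards by one step. *)
Definition missing_pos n (x : corner) : 'I_n.+4 :=
  match x with
  | (false, false) => penult _
  | (false, true) => ord0
  | (true, true) => second _
  | (true, false) => ord_max
  end.

Definition missing_val n (x : corner) : 'I_n.+4 :=
  match x with
  | (false, false) => ord0
  | (false, true) => second _
  | (true, true) => ord_max
  | (true, false) => penult _
  end.

Ltac ord_arith :=
  try apply/val_inj; rewrite /= ?val_second ?val_penult /bump /=; lia.

(** The definition inserts the lower left point last; commuting the insertions
    lets any one of the four outer points be inserted last. *)
Lemma raw_balloonE n x (s : 'S_n) :
  raw_balloon s = lift_perm (missing_pos n x) (missing_val n x) (raw_shell x s).
Proof.
case: x => [[] []]; 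
  rewrite /raw_balloon /raw_shell /missing_pos /missing_val /extreme //=.
- rewrite (@lift_permC _ _ ord0 (second _) (second _) ord_max ord0 ord_max ord0 (second _));
    try ord_arith.
  congr lift_perm.
  rewrite (@lift_permC _ _ ord0 (second _) ord_max ord_max ord_max ord_max ord0 (second _));
    try ord_arith.
  congr lift_perm.
  by apply: lift_permC; ord_arith.
- rewrite (@lift_permC _ _ ord0 ord_max ord_max (penult _) ord_max ord_max ord0 ord_max);
    try ord_arith.
  rewrite (@lift_permC _ _ ord0 (second _) ord_max (penult _) ord_max (penult _) ord0 (second _));
    try ord_arith.
  congr lift_perm.
  rewrite (@lift_permC _ _ ord0 ord_max ord_max ord0 ord_max ord0 ord0 ord_max);
    try ord_arith.
  by apply: lift_permC; ord_arith.
- rewrite (@lift_permC _ _ ord_max ord_max (penult _) ord0 ord_max ord0 ord_max ord_max);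
    try ord_arith.
  rewrite (@lift_permC _ _ ord0 ord_max (penult _) ord0 (penult _) ord0 ord0 ord_max);
    try ord_arith.
  by apply: lift_permC; ord_arith.
Qed.

Definition balloon (l : permutation) : permutation :=
  perm_of (raw_balloon (tagged l)).
Definition perm2413 : permutation := perm_of (raw_balloon (1%g : 'S_0)).

Lemma length_balloon l : length (balloon l) = length l + 4.
Proof. by rewrite !addnS addn0. Qed.

Lemma balloon_inj : injective balloon.
Proof.
move=> l m e; have := congr1 (@tag _ _) e => /= -[].
case: l m e => [k l] [n m] /= e ekn; case: _ / ekn m e => m.
by move=> /(@perm_of_inj _ _ _); do 4 move/lift_perm_inj; move=> /= ->.
Qed.

Lemma balloon_neq_perm2413 l : balloon l <> perm2413.
Proof. by move/(congr1 (@tag _ _)). Qed.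

Lemma shell_le_balloon x l : (shell x l <= balloon l)%O.
Proof.
apply/le_embP; exists (lift (missing_pos _ x)); rewrite /= (raw_balloonE x).
exact: emb_lift.
Qed.

(** The first and the last entry of a balloon are its second least and second
    greatest values. *)
Lemma raw_balloon_corners n x (s : 'S_n) :
  ~~ has_corner x (perm_of (raw_balloon s)).
Proof.
have e0 : raw_balloon s ord0 = second _ by rewrite lift_perm_id.
have e1 : raw_balloon s ord_max = penult _
  by rewrite (raw_balloonE (true, false)) lift_perm_id.
rewrite /has_corner /=; case: x => [[] []] /=;
  rewrite ?e0 ?e1 -val_eqE /= /bump /=; lia.
Qed.

(** The embedding is extended point by point, in the order in which the outer
    points are inserted. *)
Lemma raw_balloon_emb m n (s : 'S_m) (p : 'S_n) i :
  emb s p i -> exists j, emb (raw_balloon s) (raw_balloon p) j.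
Proof.
move=> ei.
have sideT k (r : 'I_k) : (k <= r) = false by rewrite leqNgt ltn_ord.
have e1 := @emb_extend _ _ _ _ ord_max ord0 ord_max ord0 _ ei
  (fun k => etrans (sideT _ _) (esym (sideT _ _))) (fun k => erefl).
have e2 := @emb_extend _ _ _ _ ord_max ord_max ord_max ord_max _ e1
  (fun k => etrans (sideT _ _) (esym (sideT _ _)))
  (fun k => etrans (sideT _ _) (esym (sideT _ _))).
have e3 := @emb_extend _ _ _ _ ord0 ord_max ord0 ord_max _ e2
  (fun k => erefl) (fun k => etrans (sideT _ _) (esym (sideT _ _))).
eexists; apply: (emb_extend e3) => // k.
case: (unliftP ord0 k) => [k1|] ->; last first.
  by rewrite extend_id !lift_perm_id.
rewrite extend_lift !lift_perm_lift.
case: (unliftP ord_max k1) => [k2|] ->; last first.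
  by rewrite extend_id !lift_perm_id /= /bump; lia.
rewrite extend_lift !lift_perm_lift.
case: (unliftP ord_max k2) => [k3|] ->; last first.
  by rewrite extend_id !lift_perm_id /= /bump; lia.
by rewrite extend_lift !lift_perm_lift /= /bump; lia.
Qed.

Lemma balloon_mono l m : (l <= m)%O -> (balloon l <= balloon m)%O.
Proof. by case/le_embP=> i /raw_balloon_emb[j ej]; apply/le_embP; exists j. Qed.

Lemma perm2413_le_balloon l : (perm2413 <= balloon l)%O.
Proof.
have [|j ej] := @raw_balloon_emb 0 _ (1%g : 'S_0) (tagged l)
  (fun i => let: Ordinal _ h := i in False_rect _ (notF h)).
  by split; case.
by apply/le_embP; exists j.
Qed.

(** A point sent to the first or last position is itself first or last, and the
    same holds for values, so deleting it is an explicit insertion reversed. *)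
Lemma emb_peel m n (s : 'S_m.+1) (p : 'S_n) b v i r :
  emb s (lift_perm (extreme n b) v p) i -> i r = extreme n b ->
  exists s' j, [/\ s = lift_perm (extreme m b) (s (extreme m b)) s', emb s' p j,
    forall k t, i k = lift (extreme n b) t ->
        exists2 k', k = lift (extreme m b) k' & j k' = t
    & forall c, v = extreme n c -> s (extreme m b) = extreme m c].
Proof.
move=> ei ir; have [s' [j [es ej ij]]] := emb_split ei ir.
have r_extreme := emb_extreme ei ir; rewrite r_extreme in ir es ij.
exists s', j; split=> // [k t|c vc].
  case: (unliftP (extreme m b) k) => [k' ->|->]; last first.
    by rewrite ir => /eqP; rewrite (negbTE (neq_lift _ _)).
  by rewrite ij => /lift_inj <-; exists k'.
by apply: (emb_extreme_val ei); rewrite ir lift_perm_id.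
Qed.

(** An embedding that uses the four outer points comes from a balloon.  Deleting
    these points one by one shows that the last three are corners; the value of
    the first one is determined by comparing it with its neighbours in value. *)
Lemma emb_raw_balloon m n (s : 'S_m.+1) (p : 'S_n) i :
  emb s (raw_balloon p) i -> (forall x, exists r, i r = missing_pos _ x) ->
  exists k (t : 'S_k) j, perm_of s = perm_of (raw_balloon t) /\ emb t p j.
Proof.
move=> ei hit.
have [[ra ira] [rb irb]] := (hit (false, true), hit (true, true)).
have [[rc irc] [rd ird]] := (hit (false, false), hit (true, false)).
have lt := emb_ltn _ _ ei.
have m3 : 3 <= m.
  (* Four increasing positions, so the length is at least 4. *)
  have h1 : ra < rb by rewrite -lt ira irb.
  have h2 : rb < rc by rewrite -lt irb irc val_penult.
  have h3 : rc < rd by rewrite -lt irc ird val_penult.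
  by have := leq_ord rd; lia.
case: m m3 s i ei {hit lt} ra ira rb irb rc irc rd ird => [|[|[|k]]] // _.
move=> s i ei ra ira rb irb rc irc rd ird.
have [s1 [j1 [es e1 pt1 _]]] := @emb_peel _ _ _ _ false _ _ _ ei ira.
have [rb1 rbE jb1] := pt1 rb ord0 irb.
have [rd1 rdE jd1] : exists2 r', rd = lift ord0 r' & j1 r' = ord_max.
  by apply: pt1; rewrite ird; apply/val_inj.
have [rc1 rcE jc1] : exists2 r', rc = lift ord0 r' & j1 r' = penult _.
  by apply: pt1; rewrite irc; ord_arith.
have [s2 [j2 [es1 e2 pt2 v2]]] := @emb_peel _ _ _ _ false _ _ _ e1 jb1.
have [rd2 rd1E jd2] : exists2 r', rd1 = lift ord0 r' & j2 r' = ord_max.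
  by apply: pt2; rewrite jd1; apply/val_inj.
have [rc2 rc1E jc2] : exists2 r', rc1 = lift ord0 r' & j2 r' = penult _.
  by apply: pt2; rewrite jc1; ord_arith.
have [s3 [j3 [es2 e3 pt3 v3]]] := @emb_peel _ _ _ _ true _ _ _ e2 jd2.
have [rc3 rc2E jc3] := pt3 rc2 ord_max jc2.
have [s4 [j4 [es3 e4 pt4 v4]]] := @emb_peel _ _ _ _ true _ _ _ e3 jc3.
rewrite (v2 true erefl) in es1; rewrite (v3 true erefl) in es2.
rewrite (v4 false erefl) in es3.
exists k, s4, j4; split=> //; congr perm_of.
suff v_second : s ord0 = second _ by rewrite es v_second es1 es2 es3.
have ra0 : ra = ord0 := @emb_extreme _ _ _ _ _ _ false ei ira.
have s1c : s1 rc1 = ord0.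
  have rc3E : rc3 = ord_max := @emb_extreme _ _ _ _ _ _ true e3 jc3.
  rewrite rc1E rc2E rc3E es1 lift_perm_lift es2 lift_perm_lift es3 lift_perm_id.
  by apply/val_inj.
have es' := ei.2; have sa : s ra = s ord0 by rewrite ra0.
have pa : raw_balloon p (i ra) = second _ by rewrite ira lift_perm_id.
have pc : raw_balloon p (i rc) = ord0.
  by rewrite irc (@raw_balloonE _ (false, false)) lift_perm_id.
have sc : s rc = lift (s ord0) ord0.
  by rewrite rcE [in LHS]es lift_perm_lift s1c.
have v_ge1 : 1 <= s ord0.
  have : s rc < s ra by rewrite -es' pc pa.
  by rewrite sa sc /= /bump; lia.
(* If the first value were at least 2, then [q], the point of value 1 among the
   others, would be a second point below it; but only one point of the balloon
   lies below its first entry. *)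
pose q := (s1^-1)%g (second _).
have sq : s (lift ord0 q) = lift (s ord0) (second _).
  by rewrite [in LHS]es lift_perm_lift permKV.
have v_le1 : s ord0 < 2.
  rewrite ltnNge; apply/negP => v2'.
  have : raw_balloon p (i (lift ord0 q)) < raw_balloon p (i ra).
    by rewrite es' sa sq /= /bump; lia.
  rewrite pa ltnS leqn0 => /eqP e0.
  have : raw_balloon p (i (lift ord0 q)) = raw_balloon p (i rc) by rewrite pc; apply/val_inj.
  move=> /perm_inj/(emb_inj ei); rewrite rcE => /lift_inj qc.
  by move: s1c; rewrite -qc permKV.
by apply: ord_inj; rewrite val_second; lia.
Qed.

Lemma emb_raw_balloon_cases m n (s : 'S_m.+1) (p : 'S_n) i :
  emb s (raw_balloon p) i ->
  (exists x j, emb s (raw_shell x p) j) \/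
  (exists k (t : 'S_k) j, perm_of s = perm_of (raw_balloon t) /\ emb t p j).
Proof.
move=> ei.
case: (boolP [forall x : corner, exists r, i r == missing_pos _ x]);
  [move/forallP=> hit|].
  right; apply: (emb_raw_balloon ei) => x.
  by have /existsP[r /eqP] := hit x; exists r.
rewrite negb_forall => /existsP[x]; rewrite negb_exists => /forallP miss.
left; exists x; move: ei; rewrite (raw_balloonE x) => ei.
by have [j ej _] := emb_drop ei miss; exists j.
Qed.

Lemma le_balloon_cases l b : (l <= balloon b)%O ->
  [\/ below_shells b l, l = perm2413 | exists2 t, l = balloon t & (t <= b)%O].
Proof.
case/le_embP=> i /emb_raw_balloon_cases[[x [j ej]]|[k [t [j [e ej]]]]].
  by constructor 1; apply/existsP; exists x; apply/le_embP; exists j.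
have lE : l = perm_of (raw_balloon t) by case: (l) e.
case: k t j lE ej {e} => [|k] t j lE ej; [constructor 2 | constructor 3].
  by rewrite lE; congr (perm_of (raw_balloon _)); apply/permP; case.
by exists (perm_of t) => //; apply/le_embP; exists j.
Qed.

(** * The Moebius function of a balloon *)

Local Open Scope ring_scope.

Lemma sum_upto_shrink M N (P : pred permutation) (F : permutation -> int) :
  (M <= N)%N -> (forall l, P l -> length l <= M)%N ->
  \sum_(l <- upto N | P l) F l = \sum_(l <- upto M | P l) F l.
Proof.
move=> MN PM; rewrite -[LHS]big_filter -[RHS]big_filter.
apply: perm_big; apply: uniq_perm; rewrite ?filter_uniq ?uniq_upto // => l.
rewrite !mem_filter !mem_upto; case: (boolP (P l)) => //= /PM lM.
by rewrite lM (leq_trans lM MN).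
Qed.

(** Membership in the image of [balloon], as a boolean so that it can select the
    terms of a sum. *)
Definition nonempty_balloon (l : permutation) : bool :=
  l \in [seq balloon t | t <- upto (length l)].

Lemma nonempty_balloonP l :
  reflect (exists t, l = balloon t) (nonempty_balloon l).
Proof.
apply: (iffP mapP) => [[t _ ->]|[t ->]]; exists t => //.
by rewrite mem_upto length_balloon leq_addr.
Qed.

Lemma balloon_corners x l : ~~ has_corner x (balloon l).
Proof. exact: raw_balloon_corners. Qed.

Lemma perm2413_corners x : ~~ has_corner x perm2413.
Proof. exact: raw_balloon_corners. Qed.

Lemma le_balloon l : (l <= balloon l)%O.
Proof.
apply: le_trans (shell_le_balloon (false, false) l).
by do 2 (apply: le_trans (le_add_corner _ _)); exact: le_add_corner.
Qed.

Lemma le_balloon2 l m : (balloon l <= balloon m)%O = (l <= m)%O.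
Proof.
apply/idP/idP => [|/balloon_mono //] /le_balloon_cases.
case=> [|/balloon_neq_perm2413 //|[t /balloon_inj -> //]].
rewrite below_shells_none => [|x]; last exact: balloon_corners.
exact/le_trans/le_balloon.
Qed.

Lemma below_shells_balloon t b :
  below_shells b (balloon t) = (balloon t <= b)%O.
Proof. by apply: below_shells_none => x; exact: balloon_corners. Qed.

Lemma below_shells_perm2413 b : below_shells b perm2413 = (perm2413 <= b)%O.
Proof. by apply: below_shells_none => x; exact: perm2413_corners. Qed.

(** The vanishing of the sum of mu below [balloon b], once the permutations below
    a shell are taken out; 2413 stands for the empty permutation. *)
Lemma sum_balloon b N : (length b + 4 <= N)%N ->
  \sum_(t <- upto N | (t <= b)%O) mu (balloon t) =
  \sum_(t <- upto N | (balloon t <= b)%O) mu (balloon t)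
  + (b == one)%:R - (~~ (perm2413 <= b)%O)%:R * mu perm2413.
Proof.
move=> bN.
have balN l : (l <= balloon b)%O -> (length l <= N)%N.
  by move/le_length; rewrite length_balloon => /leq_trans; apply.
have bN' : (length b + 3 <= N)%N by lia.
have := @mu_sum_le N (balloon b); rewrite length_balloon => /(_ bN).
have -> : (balloon b == one) = false by apply/eqP => /(congr1 (@tag _ _)).
rewrite (@mu_sum_split _ (below_shells b)).
rewrite (@eq_mu_sum _ (fun l => _ b l && _) (below_shells b)); last first.
  move=> l; case: (boolP (below_shells b l)) => //= /existsP[x lx].
  exact: le_trans lx (shell_le_balloon _ _).
rewrite mu_sum_below_shells //.
rewrite (@mu_sum_split _ (pred1 perm2413)).
have -> : mu_sum N (fun l =>
          pred1 perm2413 l && (~~ below_shells b l && (l <= balloon b)%O))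
        = (~~ (perm2413 <= b)%O)%:R * mu perm2413.
  case: (boolP (perm2413 <= b)%O) => pb /=.
    rewrite mul0r /mu_sum big1 // => l /andP[/eqP -> ].
    by rewrite below_shells_perm2413 pb.
  rewrite mul1r -(@mu_sum_eq1 N); last by rewrite balN // perm2413_le_balloon.
  apply: eq_mu_sum => l /=; case: eqP => //= ->.
  by rewrite below_shells_perm2413 pb perm2413_le_balloon.
rewrite (@eq_mu_sum _ (fun l => ~~ _ && _)
  (fun l => nonempty_balloon l && (~~ (l <= b)%O && (l <= balloon b)%O)));
  last first.
  move=> l /=; apply/idP/idP => [/and3P[np nb lb]|]; last first.
    case/and3P => /nonempty_balloonP[t ->] tb lb.
    by rewrite lb below_shells_balloon tb.
  case: (le_balloon_cases lb) nb np => [-> //|-> /=|[t lE tb] nb _].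
    by rewrite eqxx.
  rewrite lb andbT; apply/andP; split; first by apply/nonempty_balloonP; exists t.
  by move: nb; rewrite lE below_shells_balloon.
rewrite /mu_sum (@sum_upto_image N balloon) //; first last.
- by move=> l /andP[_ /balN].
- exact: nonempty_balloonP.
- by move=> l; rewrite length_balloon leq_addr.
- exact: balloon_inj.
under eq_bigl do rewrite le_balloon2 andbC.
rewrite [in X in _ -> X = _](bigID (fun t => balloon t <= b)%O) /=.
rewrite (eq_bigl (fun t => balloon t <= b)%O
  (P1 := fun t => (t <= b)%O && (balloon t <= b)%O)).
  move=> e; have {}e : _ = 0 := e.
  by apply/eqP; rewrite -subr_eq0; apply/eqP; rewrite -[RHS]e; ring.
move=> t; case: (boolP (balloon t <= b)%O) => [h|]; rewrite ?andbF //.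
by rewrite (le_trans (le_balloon t) h).
Qed.

Definition is_balloon l := (l == perm2413) || nonempty_balloon l.

(** Turns the last sum of [sum_balloon] into a sum of mu below [b] itself. *)
Lemma sum_is_balloon b N : (length b + 4 <= N)%N ->
  mu_sum N (fun l => is_balloon l && (l <= b)%O) =
  \sum_(t <- upto N | (balloon t <= b)%O) mu (balloon t) +
  (perm2413 <= b)%O%:R * mu perm2413.
Proof.
move=> bN; rewrite (@mu_sum_split _ (pred1 perm2413)) addrC; congr (_ + _).
  rewrite -(@sum_upto_image N balloon nonempty_balloon (fun l => l <= b)%O); first last.
  - by move=> l /le_length; lia.
  - exact: nonempty_balloonP.
  - by move=> l; rewrite length_balloon leq_addr.
  - exact: balloon_inj.
  apply: eq_mu_sum => l; rewrite /is_balloon /=; case: eqP => //= ->.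
  by case: nonempty_balloonP => // -[t /esym/balloon_neq_perm2413].
case: (boolP (perm2413 <= b)%O) => pb /=.
  rewrite mul1r -(@mu_sum_eq1 N); last by move/le_length: pb; lia.
  by apply: eq_mu_sum => l /=; case: eqP => //= ->; rewrite /is_balloon eqxx pb.
by rewrite mul0r /mu_sum big1 // => l /and3P[/eqP -> _]; rewrite (negbTE pb).
Qed.

(** The error in the formula of [mu_balloon]. *)
Definition defect l : int := mu (balloon l) - (is_balloon l)%:R * mu l - mu l.

Lemma sum_defect b :
  \sum_(t <- upto (length b) | (t <= b)%O) defect t = - mu perm2413.
Proof.
have le_len l : (l <= b)%O -> (length l <= length b)%N by exact: le_length.
rewrite -(@sum_upto_shrink _ (length b + 4)) ?leq_addr //.
rewrite !sumrB (sum_balloon (leqnn _)).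
have -> : \sum_(t <- upto (length b + 4) | (t <= b)%O) (is_balloon t)%:R * mu t =
  mu_sum (length b + 4) (fun l => is_balloon l && (l <= b)%O).
  rewrite /mu_sum big_mkcond [RHS]big_mkcond; apply: eq_bigr => t _.
  by case: (is_balloon t); rewrite ?mul1r ?mul0r //=; case: ifP.
rewrite sum_is_balloon // -/(mu_sum _ _) mu_sum_le ?leq_addr //.
by case: (perm2413 <= b)%O => /=; ring.
Qed.

Lemma defect_one : defect one = - mu perm2413.
Proof.
rewrite -(sum_defect one) -[LHS](@sum_upto_eq1 (length one) defect) //.
apply: eq_bigl => l; apply/eqP/idP => [-> //|l1].
by apply: le_anti; rewrite l1 one_le.
Qed.

(** The constant sum of [sum_defect] is already reached at the term 1, so by
    induction every other term is 0. *)
Lemma defect_eq0 b : b != one -> defect b = 0.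
Proof.
have [n bn] := ubnP (length b); elim: n b bn => // n IH b bn b1.
have := sum_defect b; rewrite (bigID (pred1 b)) /=.
rewrite (eq_bigl (pred1 b)); last first.
  by move=> l /=; case: eqP => [->|]; rewrite ?lexx ?andbF.
rewrite sum_upto_eq1 // (bigID (pred1 one)) /= [X in _ + (_ + X)]big1; last first.
  move=> l /andP[/andP[lb nlb] l1]; apply: IH => //.
  rewrite -ltnS (leq_trans _ bn) // ltnS.
  by apply: perm_lt_length; rewrite lt_neqAle nlb.
rewrite (eq_bigl (pred1 one)); last first.
  move=> l /=; case: (l =P one) => [->|]; rewrite ?andbF //.
  by rewrite one_le eq_sym b1.
rewrite sum_upto_eq1 // defect_one addr0 => e.
by apply: (addIr (- mu perm2413)); rewrite e add0r.
Qed.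

Lemma mu_balloon b : b != one ->
  mu (balloon b) = (if is_balloon b then 2 else 1) * mu b.
Proof.
move/defect_eq0; rewrite /defect; case: (is_balloon b) => /= /eqP;
  rewrite subr_eq0 subr_eq => /eqP ->; ring.
Qed.

(** The counterpart of [shell] for the empty permutation: only two corners are
    added to 1, which takes the place of the third point. *)
Definition empty_shell x := add_corner x (add_corner (turn x) one).

Lemma has_corner_add_one x y :
  has_corner x (add_corner y one) = (x == y) || (x == flip y).
Proof.
have y1 := has_add_corner y one; have := has_flip_corner y one.
rewrite eqxx orbT => y2.
case: (corner_cases y x) => ->; rewrite ?eqxx ?orbT ?y1 ?y2 //.
  by rewrite (negbTE (has_corner_turn y1)); case: (y) => [[] []].
by rewrite (negbTE (has_corner_turn y2)); case: (y) => [[] []].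
Qed.

Lemma has_corner_empty_shell y x : has_corner y (empty_shell x) = (y == x).
Proof.
have x1 := has_add_corner x (add_corner (turn x) one).
case: (corner_cases x y) => ->; rewrite ?eqxx ?x1.
- by [].
- by rewrite (negbTE (has_corner_turn x1)); case: (x) => [[] []].
- rewrite has_flip_corner (negbTE (has_corner_turnN _)); last first.
    by rewrite has_corner_add_one; case: (x) => [[] []].
  by case: (x) => [[] []].
- rewrite (negbTE (has_corner_turnN _)); first by case: (x) => [[] []].
  by rewrite turn_turn flipK.
Qed.

Lemma add_flip_corner_one x : add_corner (flip x) one = add_corner x one.
Proof.
have /has_cornerP[l e] : has_corner (flip x) (add_corner x one)
  by rewrite has_flip_corner eqxx orbT.
by rewrite e; congr add_corner; apply/esym/tag_eq0; case: (congr1 (@tag _ _) e).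
Qed.

Lemma raw_empty_shell x : perm_of (raw_shell x (1%g : 'S_0)) = empty_shell x.
Proof.
congr (perm_of (lift_perm _ _ (lift_perm _ _ _))).
by apply/permP=> k; apply/val_inj; rewrite !ord1.
Qed.

Lemma le_perm2413 l : (l <= perm2413)%O ->
  l = perm2413 \/ exists x, (l <= empty_shell x)%O.
Proof.
case/le_embP=> i /emb_raw_balloon_cases[[x [j ej]]|[k [t [j [e ej]]]]].
  by right; exists x; rewrite -raw_empty_shell; apply/le_embP; exists j.
left; have -> : l = perm_of (raw_balloon t) by case: (l) e.
case: k t j ej {e} => [|k] t j ej; last by case: (j ord0).
by congr (perm_of (raw_balloon _)); apply/permP; case.
Qed.

Lemma empty_shell_le x : (empty_shell x <= perm2413)%O.
Proof.
rewrite -raw_empty_shell; apply/le_embP; exists (lift (missing_pos _ x)).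
rewrite [tagged perm2413](raw_balloonE x); exact: emb_lift.
Qed.

Lemma le_one_eq l : (l <= one)%O = (l == one).
Proof.
apply/idP/eqP => [l1|-> //].
by apply: le_anti; rewrite l1 one_le.
Qed.

Lemma le_add_corner_one l x :
  (l <= add_corner x one)%O = (l == one) || (l == add_corner x one).
Proof.
case: (boolP (has_corner x l)) => [/has_cornerP[l' ->]|nx]; last first.
  rewrite (le_add_corner_none _ nx) le_one_eq; case: eqP => //= _.
  by apply/esym; apply: contraNF nx => /eqP ->; exact: has_add_corner.
rewrite le_add_corner2 le_one_eq (inj_eq (@add_corner_inj x)).
by case: eqP => [->|] //.
Qed.

(** The permutations contained in 2413: itself, 1, 12, 21 and its four patterns
    of length 3. *)
Definition below2413 : seq permutation :=
  perm2413 :: one :: add_corner (false, false) one :: add_corner (false, true) one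
  :: [seq empty_shell x | x <- enum {: corner}].

Lemma mem_below2413 l : (l <= perm2413)%O = (l \in below2413).
Proof.
rewrite !inE; apply/idP/idP => [/le_perm2413[->|[x]]|].
- by rewrite eqxx.
- case: (boolP (has_corner x l)) => [/has_cornerP[l' ->]|nx] lx.
    move: lx; rewrite le_add_corner2 le_add_corner_one => /orP[] /eqP ->; last first.
      have -> : add_corner x (add_corner (turn x) one) \in
                [seq empty_shell y | y <- enum {: corner}].
        by apply/mapP; exists x; rewrite ?mem_enum.
      by rewrite !orbT.
    case: x => [[] []]; rewrite ?eqxx ?orbT //.
      by rewrite -(add_flip_corner_one (true, true)) eqxx ?orbT.
    by rewrite -(add_flip_corner_one (true, false)) eqxx ?orbT.
  move: lx; rewrite (le_add_corner_none _ nx) le_add_corner_one => /orP[]/eqP ->.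
    by rewrite eqxx orbT.
  case: x {nx} => [[] []]; rewrite /turn /= ?eqxx ?orbT //.
    by rewrite -(add_flip_corner_one (true, false)) eqxx ?orbT.
  by rewrite -(add_flip_corner_one (true, true)) eqxx ?orbT.
have le1 x : (add_corner x one <= perm2413)%O.
  apply: le_trans (empty_shell_le x).
  by rewrite le_add_corner2 one_le.
case/or4P => [/eqP->|/eqP->|/eqP->|/orP[/eqP->|/mapP[x _ ->]]].
- exact: lexx.
- exact: one_le.
- exact: le1.
- exact: le1.
- exact: empty_shell_le.
Qed.

Lemma uniq_below2413 : uniq below2413.
Proof.
have inj1 : injective empty_shell.
  by move=> x y e; apply/eqP; rewrite -has_corner_empty_shell -e has_corner_empty_shell.
have len (m : nat) (s : seq permutation) l : length l = m ->
    all (fun t => length t != m) s -> l \notin s.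
  by move=> lm /allP h; apply/negP => /h; rewrite lm eqxx.
have shells m : m != 3 ->
    all (fun t => length t != m) [seq empty_shell x | x <- enum {: corner}].
  by move=> m3; apply/allP => _ /mapP[x _ ->]; rewrite eq_sym.
rewrite /below2413 !cons_uniq map_inj_uniq // enum_uniq andbT.
apply/and4P; split.
- by apply: (len 4) => //=; apply: shells.
- by apply: (len 1) => //=; apply: shells.
- rewrite inE negb_or; apply/andP; split;
    last by apply: (len 2) => //; apply: shells.
  apply/eqP => e; have := has_add_corner (false, false) one.
  by rewrite e has_corner_add_one.
- by apply: (len 2) => //; apply: shells.
Qed.

Lemma mu_corner_one x : mu (add_corner x one) = -1.
Proof. by rewrite mu_add_corner mu_one. Qed.

Lemma mu_empty_shell x : mu (empty_shell x) = 1.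
Proof.
rewrite mu_add_corner mu_corner_one (negbTE (has_corner_turnN _)) ?opprK //.
exact: has_add_corner.
Qed.

Lemma mu_perm2413 : mu perm2413 = -3.
Proof.
have := @mu_sum_le 4 perm2413 (leqnn _).
rewrite /mu_sum (eq_bigl (fun l => l \in below2413)); last exact: mem_below2413.
rewrite -big_filter (perm_big below2413); last first.
  apply: uniq_perm; [exact/filter_uniq/uniq_upto | exact: uniq_below2413|].
  move=> l; rewrite mem_filter mem_upto andbC.
  case: (boolP (l \in _)); rewrite ?andbF //.
  by rewrite -mem_below2413 => /le_length ->.
rewrite /below2413 !big_cons big_map mu_one !mu_corner_one.
rewrite (eq_bigr (fun=> 1)) => [|x _]; last exact: mu_empty_shell.
have -> : \sum_(x <- enum {: corner}) (1 : int) = 4.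
  by rewrite big_enum sumr_const card_prod card_bool.
have -> : perm2413 == one = false by apply/eqP => /(congr1 (@tag _ _)).
by move: (mu perm2413) => z /=; lia.
Qed.

(** The value 4 of 25314 shows that 1 is a true exception in [mu_balloon]. *)
Lemma mu_balloon_one : mu (balloon one) = 4.
Proof.
have := defect_one; rewrite /defect mu_one.
have -> : is_balloon one = false.
  apply/negbTE; rewrite negb_or; apply/andP; split.
    by apply/eqP => /(congr1 (@tag _ _)).
  by apply/nonempty_balloonP => -[t /(congr1 (@tag _ _))].
by rewrite mu_perm2413; lia.
Qed.

(** * Growth *)

Lemma is_balloon_balloon l : is_balloon (balloon l).
Proof. by apply/orP; right; apply/nonempty_balloonP; exists l. Qed.

Lemma small_nonzero r : (0 < r < 4)%N ->
  exists2 l, length l = r & `|mu l|%N = 1%N.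
Proof.
case: r => [|[|[|[|r]]]] // _.
- by exists one; rewrite ?mu_one.
- by exists (add_corner (false, false) one); rewrite ?mu_corner_one.
- by exists (empty_shell (false, false)); rewrite ?mu_empty_shell.
Qed.

(** The start needs a balloon of each length 4, 5, 6, 7, since only balloons are
    doubled. *)
Lemma large_balloon k r : (r < 4)%N ->
  exists l,
    [/\ length l = (k * 4 + r + 4)%N, is_balloon l & (2 ^ k <= `|mu l|)%N].
Proof.
move=> r4; elim: k => [|k [l [ll lb lf]]]; last first.
  have l1 : l != one by apply/eqP => l1; move: ll; rewrite l1 /length /=; lia.
  exists (balloon l); split; first by rewrite length_balloon ll; lia.
    exact: is_balloon_balloon.
  by rewrite mu_balloon // lb abszM expnS leq_mul.
case: r r4 => [|[|r]] r4.
- by exists perm2413; rewrite mu_perm2413 /is_balloon eqxx.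
- by exists (balloon one); rewrite mu_balloon_one is_balloon_balloon.
have [l ll lf] := @small_nonzero r.+2 r4.
have l1 : l != one by apply/eqP => l1; move: ll; rewrite l1.
exists (balloon l).
rewrite length_balloon ll is_balloon_balloon mu_balloon //; split=> //.
by rewrite abszM lf muln1; case: ifP.
Qed.

Lemma le_max_mu l : (`|mu l| <= max_mu (length l))%N.
Proof.
case: l => n l; rewrite /max_mu /=.
exact: (@leq_bigmax _ (fun p : 'S_n.+1 => `|mobius one (perm_of p)|%N) l).
Qed.

Theorem theorem13 (n : nat) (hn : (1 <= n)%N) :
  (2%:Q ^ ((n %/ 4)%N%:Z - 1) <= (max_mu n)%:R)%R.
Proof.
have := divn_eq n 4; case: (n %/ 4)%N => [|k] en.
  have [|l <- lf] := @small_nonzero n; first by rewrite hn en ltn_mod.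
  apply: (@le_trans _ _ 1) => //.
  by rewrite ler1n -lf le_max_mu.
have [|l [ll _ lf]] := @large_balloon k (n %% 4)%N; first by rewrite ltn_mod.
have -> : n = length l by rewrite ll {1}en; lia.
have -> : k.+1%:Z - 1 = k%:Z by lia.
by rewrite -exprnP -natrX ler_nat (leq_trans lf) ?le_max_mu.
Qed.
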